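(* Let $k$ be a positive integer, and let $[k/2]$ denote the integer part of $k/2$. For every $\beta\in\{0,1\}$ and every integer $j$ with $1\le j\le [k/2]$, with $c=(-1)^{1+\beta}$, the following relations hold: $$A_{j,k}^{(0,\beta)}=U_{j-1}\Big(-\frac{c}{2}A_{1,k}^{(1,1-\beta)}\Big)A_{1,k}^{(0,\beta)},$$ $$A_{j,k}^{(1,\beta)}=2c\,T_j\Big(\frac{c}{2}A_{1,k}^{(1,\beta)}\Big),$$ where $T_n$ and $U_n$ are the Chebyshev polynomials of the first and second kinds (evaluated at square matrices), and the matrices $A_{j,k}^{(\alpha,\beta)}$ are those defined in the context.
   Context: For $\alpha,\beta\in\{0,1\}$ and integers $j,k$ with $k\ge 2j\ge 2$, put $c_{\alpha,\beta}=(-1)^{\beta+1}$ and $d_{\alpha,\beta}=(-1)^{\alpha+\beta}$. The $k\times k$ matrix $A_{j,k}^{(\alpha,\beta)}=(a_{m,n})_{m,n=1}^k$ has entries: (i) $a_{m,j-m+1}=1$ for $m=1,\dots,j$; (ii) $a_{m,m+j}=d_{\alpha,\beta}$ for $m=1,\dots,k-j$; (iii) $a_{m,m-j}=c_{\alpha,\beta}$ for $m=j+1,\dots,k$; (iv) $a_{m,2k-m-j+1}=c_{\alpha,\beta}$ for $m=k-j+1,\dots,k$; (v) $a_{m,n}=0$ for all remaining pairs $(m,n)$. Chebyshev polynomials: $T_0(z)=1$, $T_1(z)=z$, $T_{n+1}(z)=2zT_n(z)-T_{n-1}(z)$; $U_0(z)=1$, $U_1(z)=2z$, $U_{n+1}(z)=2zU_n(z)-U_{n-1}(z)$.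 *)

(* Defs.v *)
From HB Require Import structures.
From mathcomp Require Import all_boot all_order all_algebra.
Set Implicit Arguments.
Unset Strict Implicit.
Unset Printing Implicit Defensive.
Import Order.TTheory GRing.Theory Num.Theory.
Local Open Scope ring_scope.

Fixpoint chebT (R : comNzRingType) (n : nat) : {poly R} :=
  match n with
  | 0 => 1
  | S p => match p with
           | 0 => 'X
           | S q => 2%:R *: 'X * chebT R p - chebT R q
           end
  end.

Fixpoint chebU (R : comNzRingType) (n : nat) : {poly R} :=
  match n with
  | 0 => 1
  | S p => match p with
           | 0 => 2%:R *: 'X
           | S q => 2%:R *: 'X * chebU R p - chebU R q
           end
  end.

Definition csign (R : comNzRingType) (beta : nat) : R :=
  (-1) ^+ (beta + 1).

Definition dsign (R : comNzRingType) (alpha beta : nat) : R :=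
  (-1) ^+ (alpha + beta).

(* m and n are the usual 1-based row and column numbers.  The four index sets
   are pairwise disjoint when 2 <= 2 * j <= k, so the order of the tests is
   immaterial there, and no subtraction below is truncated on its branch. *)
Definition Aentry (R : comNzRingType) (alpha beta j k m n : nat) : R :=
  if [&& 1 <= m, m <= j & n == j - m + 1]%N then 1
  else if [&& 1 <= m, m <= k - j & n == m + j]%N then dsign R alpha beta
  else if [&& j + 1 <= m, m <= k & n == m - j]%N then csign R beta
  else if [&& k - j + 1 <= m, m <= k & n == 2 * k - m - j + 1]%N
       then csign R beta
  else 0.

Definition Amx (R : comNzRingType) (alpha beta j k : nat) : 'M[R]_k :=
  \matrix_(r < k, s < k) Aentry R alpha beta j k r.+1 s.+1.

(* Main.v *)
Require Import Defs.
From HB Require Import structures.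
From mathcomp Require Import all_boot all_order all_algebra.
From mathcomp Require Import zify ring.
Set Implicit Arguments.
Unset Strict Implicit.
Unset Printing Implicit Defensive.
Import Order.TTheory GRing.Theory Num.Theory.
Local Open Scope ring_scope.

(** The theorem is the product formula for cosines in disguise: with the
    right boundary conditions, multiplication by a tridiagonal matrix is the sum
    of the two unit shifts on the line, and shifting by [j] in both directions
    satisfies the three-term recurrence that defines Chebyshev polynomials.

    Put [c = csign beta] and [s = (-1) ^+ (alpha + 1)].  Extend the standard
    basis [e_1, ..., e_k] of row vectors to indices outside [1 .. k] by the
    reflections [e_(1-i) = c e_i] and [e_(2k+1-i) = s e_i].  Then the four
    families of nonzero entries of [A_j] say exactly that its [m]-th row is
    [c (e_(m-j) + s e_(m+j))]: the anti-diagonal corner entries are the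
    indices that left [1 .. k] and were reflected back ([wave] and
    [Amx_waveMx]).

    This row formula makes sense for every [m].  Averaging over neighbours moves
    [j] instead of [m], so row [m-1] plus row [m+1] of [A_j] is row [m] of
    [A_(j+1) + A_(j-1)] ([wave_shift]).  The rows just outside the matrix are
    reflections of the border rows, row [0] being [s c] times row [1] and row
    [k+1] being row [k] ([wave_first], [wave_last]), so that sum of neighbours
    is left multiplication by the adjacency matrix [M] of a path on [k] points
    with a loop of weight [s c] at one end and [1] at the other
    ([loop_pathMx]).  Hence [A_(j+1) = M A_j - A_(j-1)], which is the recurrence
    of Chebyshev polynomials at [M / 2] ([waveMx_rec]).

    It remains to look at the initial values.  The row formula gives
    [A_0 = c (1 + s) I], which is [0] when [alpha = 0], whence the second kind
    times [A_1], and [2 c I] when [alpha = 1], whence the first kind.  Finally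
    [M] is a sign times one of the matrices [A_1^(1, b)] ([Amx_loop_pathMx]). *)

(** * Rows of the matrices as reflected waves *)

Section Wave.
Variable R : comNzRingType.
Implicit Types (c s e : R) (a b j k m n : nat).

(** The [n]-th coordinate of [c (e_(m-j) + s e_(m+j))] after reflection, for
    [c] and [s] of square [1].  The first two summands come from [e_(m-j)], the
    last two from [e_(m+j)].  The indices are written additively, so that nothing
    is truncated and rows [0] and [k+1] are meaningful. *)
Definition wave c s k j m n : R :=
  c *+ (n + j == m)%N + 1 *+ (m + n == j.+1)%N
  + (s * c) *+ (m + j == n)%N + c *+ (m + n + j == k.*2.+1)%N.

Lemma Aentry_wave a b j k m n :
  (0 < j)%N -> (j.*2 <= k)%N -> (0 < m <= k)%N -> (0 < n <= k)%N ->
  Aentry R a b j k m n = wave (csign R b) ((-1) ^+ a.+1) k j m n.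
Proof.
move=> j0 jk mk nk; rewrite /Aentry /wave.
have -> : [&& 1 <= m, m <= j & n == j - m + 1]%N = (m + n == j.+1)%N by lia.
have -> : [&& 1 <= m, m <= k - j & n == m + j]%N = (m + j == n)%N by lia.
have -> : [&& j + 1 <= m, m <= k & n == m - j]%N = (n + j == m)%N by lia.
have -> : [&& k - j + 1 <= m, m <= k & n == 2 * k - m - j + 1]%N
          = (m + n + j == k.*2.+1)%N by lia.
have -> : dsign R a b = (-1) ^+ a.+1 * csign R b.
  by rewrite /dsign /csign -exprD addnA !addn1 addSn !exprS !mulN1r opprK.
do 4! case: eqP => ?; try (exfalso; lia);
  by rewrite ?mulr1n ?mulr0n ?add0r ?addr0.
Qed.

(** Every term depends on [m - j] or on [m + j] alone, and each of these takes
    the same two values on the two sides. *)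
Lemma wave_shift c s k j m n : (0 < n <= k)%N ->
  wave c s k j.+2 m.+1 n + wave c s k j m.+1 n
  = wave c s k j.+1 m n + wave c s k j.+1 m.+2 n.
Proof.
move=> nk; rewrite /wave.
have -> : (n + j.+2 == m.+1)%N = (n + j.+1 == m)%N by lia.
have -> : (m.+1 + n == j.+3)%N = (m + n == j.+2)%N by lia.
have -> : (m.+1 + j.+2 == n)%N = (m.+2 + j.+1 == n)%N by lia.
have -> : (m.+1 + n + j.+2 == k.*2.+1)%N = (m.+2 + n + j.+1 == k.*2.+1)%N by lia.
have -> : (n + j == m.+1)%N = (n + j.+1 == m.+2)%N by lia.
have -> : (m.+1 + n == j.+1)%N = (m.+2 + n == j.+2)%N by lia.
have -> : (m.+1 + j == n)%N = (m + j.+1 == n)%N by lia.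
have -> : (m.+1 + n + j == k.*2.+1)%N = (m + n + j.+1 == k.*2.+1)%N by lia.
ring.
Qed.

(** Reflection in [1/2] exchanges [e_(-j)] and [e_(j+1)] up to [c].  For
    [j = 0] both summands of row [0] would need reflecting, which [wave] does
    not do, and for [j >= k] the other end interferes. *)
Lemma wave_first c s k j n : c * c = 1 -> s * s = 1 ->
  (0 < j < k)%N -> (0 < n <= k)%N ->
  wave c s k j 0 n = s * c * wave c s k j 1 n.
Proof.
move=> cc ss jk nk; rewrite /wave.
have -> : (n + j == 0)%N = false by lia.
have -> : (0 + n + j == k.*2.+1)%N = false by lia.
have -> : (n + j == 1)%N = false by lia.
have -> : (1 + n + j == k.*2.+1)%N = false by lia.
have -> : (1 + n == j.+1)%N = (0 + j == n)%N by lia.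
have -> : (0 + n == j.+1)%N = (1 + j == n)%N by lia.
have scsc : s * c * (s * c) = 1 by rewrite mulrACA ss cc mulr1.
by rewrite !mulr0n !add0r !addr0 mulrDr !mulrnAr mulr1 scsc addrC.
Qed.

(** Reflection in [k + 1/2] exchanges the summands of row [k+1] with those of
    row [k]; the factor [s] of the reflection is already absorbed in the
    coefficients of [wave], so two terms trade places. *)
Lemma wave_last c s k j n : (0 < j < k)%N -> (0 < n <= k)%N ->
  wave c s k j k.+1 n = wave c s k j k n.
Proof.
move=> jk nk; rewrite /wave.
have -> : (n + j == k.+1)%N = (k + n + j == k.*2.+1)%N by lia.
have -> : (k.+1 + n + j == k.*2.+1)%N = (n + j == k)%N by lia.
have -> : (k.+1 + n == j.+1)%N = (k + n == j.+1)%N by lia.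
have -> : (k.+1 + j == n)%N = (k + j == n)%N by lia.
ring.
Qed.

(** * The path with loops and the three-term recurrence *)

Definition loop_pathMx e k : 'M[R]_k :=
  \matrix_(r, t) (1 *+ (t.+1 == r)%N + 1 *+ (t == r.+1 :> nat)
    + e *+ (r + t == 0)%N + 1 *+ (r.+1 + t.+1 == k.*2)%N).

Lemma sum_ord_delta k (f : nat -> R) (i : nat) (P : nat -> bool) x :
  (forall t, (t < k)%N -> P t = (t == i)) -> (i < k)%N ->
  \sum_(t < k) (x *+ P t) * f t = x * f i.
Proof.
move=> PE ik; rewrite (bigD1 (Ordinal ik)) //= PE // eqxx big1 ?addr0 //.
by move=> t tNi; rewrite PE // (negPf (_ : t != i :> nat)) ?mulr0n ?mul0r.
Qed.

Lemma sum_ord_none k (f : nat -> R) (P : nat -> bool) x :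
  (forall t, (t < k)%N -> P t = false) ->
  \sum_(t < k) (x *+ P t) * f t = 0.
Proof. by move=> PE; rewrite big1 // => t _; rewrite PE // mulr0n mul0r. Qed.

(** The loops stand for the neighbours that the end points lack: any column
    whose values at [0] and [k+1] are those reflections is mapped to its sum of
    neighbours. *)
Lemma loop_pathMx_row e k (r : 'I_k) (f : nat -> R) :
  f 0 = e * f 1 -> f k.+1 = f k ->
  \sum_(t < k) loop_pathMx e k r t * f t.+1 = f r + f r.+2.
Proof.
move=> f0 fk; pose g t := f t.+1; have rk := ltn_ord r.
transitivity (\sum_(t < k) (1 *+ (t.+1 == r)%N) * g t
   + \sum_(t < k) (1 *+ (t == r.+1 :> nat)) * g t
   + \sum_(t < k) (e *+ (r + t == 0)%N) * g t
   + \sum_(t < k) (1 *+ (r.+1 + t.+1 == k.*2)%N) * g t).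
  by rewrite -!big_split; apply: eq_bigr => t _; rewrite mxE !mulrDl.
have lower : \sum_(t < k) (1 *+ (t.+1 == r)%N) * g t
           + \sum_(t < k) (e *+ (r + t == 0)%N) * g t = f r.
  have [r0|r0] := posnP r.
    rewrite (@sum_ord_none _ _ (fun t => t.+1 == r)) ?add0r; last by lia.
    rewrite (@sum_ord_delta _ _ 0%N (fun t => r + t == 0)%N); try by lia.
    by rewrite r0 f0.
  rewrite (@sum_ord_delta _ _ r.-1 (fun t => t.+1 == r)); try by lia.
  rewrite (@sum_ord_none _ _ (fun t => r + t == 0)%N) ?addr0; last by lia.
  by rewrite mul1r /g prednK.
have upper : \sum_(t < k) (1 *+ (t == r.+1 :> nat)) * g t
           + \sum_(t < k) (1 *+ (r.+1 + t.+1 == k.*2)%N) * g t = f r.+2.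
  have [rk1|rk1] := ltnP r.+1 k.
    rewrite (@sum_ord_delta _ _ r.+1 (fun t => t == r.+1)); try by lia.
    rewrite (@sum_ord_none _ _ (fun t => r.+1 + t.+1 == k.*2)%N) ?addr0;
      last by lia.
    by rewrite mul1r.
  rewrite (@sum_ord_none _ _ (fun t => t == r.+1)) ?add0r; last by lia.
  rewrite (@sum_ord_delta _ _ r (fun t => r.+1 + t.+1 == k.*2)%N); try by lia.
  have rE : r.+1 = k by lia.
  by rewrite mul1r /g rE fk.
by rewrite -lower -upper -!addrA; congr (_ + _); rewrite addrCA.
Qed.

Definition waveMx c s k j : 'M[R]_k :=
  \matrix_(r, t) wave c s k j r.+1 t.+1.

Lemma Amx_waveMx a b j k : (0 < j)%N -> (j.*2 <= k)%N ->
  Amx R a b j k = waveMx (csign R b) ((-1) ^+ a.+1) k j.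
Proof.
move=> j0 jk; apply/matrixP => r t; rewrite !mxE.
by rewrite Aentry_wave // ltn_ord.
Qed.

Lemma waveMx0 c s k : waveMx c s k 0 = (c * (1 + s))%:M.
Proof.
apply/matrixP => r t; have := ltn_ord r; have := ltn_ord t => tk rk.
rewrite !mxE /wave !addn0.
have -> : (t.+1 == r.+1)%N = (r == t) by rewrite eqSS eq_sym.
have -> : (r.+1 == t.+1)%N = (r == t) by rewrite eqSS.
have -> : (r.+1 + t.+1 == 1)%N = false by lia.
have -> : (r.+1 + t.+1 == k.*2.+1)%N = false by lia.
by rewrite !mulr0n !addr0 -mulrnDl mulrDr mulr1 (mulrC c s).
Qed.

Lemma waveMx_rec c s k j : c * c = 1 -> s * s = 1 -> (j.+1 < k)%N ->
  waveMx c s k j.+2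
  = loop_pathMx (s * c) k *m waveMx c s k j.+1 - waveMx c s k j.
Proof.
move=> cc ss jk; apply/eqP; rewrite eq_sym subr_eq eq_sym.
apply/eqP/matrixP => r t; rewrite !mxE wave_shift ?ltn_ord //.
rewrite -(@loop_pathMx_row (s * c) k r (fun m => wave c s k j.+1 m t.+1)).
- by apply: eq_bigr => i _; congr (_ * _); rewrite mxE.
- by rewrite wave_first ?ltn_ord.
- by rewrite wave_last ?ltn_ord.
Qed.

Lemma csign_sqr b : csign R b * csign R b = 1.
Proof. by rewrite -expr2 /csign sqrr_sign. Qed.

Lemma Amx_loop_pathMx b k : (1 < k)%N ->
  Amx R 1 b 1 k = csign R b *: loop_pathMx (csign R b) k.
Proof.
move=> k1; rewrite Amx_waveMx //; apply/matrixP => r t; rewrite !mxE.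
rewrite /wave sqrrN expr1n mul1r !mulrDr !mulrnAr csign_sqr mulr1.
have -> : (t.+1 + 1 == r.+1)%N = (t.+1 == r)%N by lia.
have -> : (r.+1 + t.+1 == 2)%N = (r + t == 0)%N by lia.
have -> : (r.+1 + 1 == t.+1)%N = (t == r.+1 :> nat)%N by lia.
have -> : (r.+1 + t.+1 + 1 == k.*2.+1)%N = (r.+1 + t.+1 == k.*2)%N by lia.
by rewrite -!addrA; congr (_ + _); rewrite addrCA.
Qed.

(** * Chebyshev polynomials of a matrix *)

Lemma horner_mx_double k (X : 'M[R]_k.+1) : horner_mx X (2%:R *: 'X) = 2%:R *: X.
Proof. by rewrite linearZ /= horner_mx_X. Qed.

Lemma horner_mx_chebU_rec k (X : 'M[R]_k.+1) j :
  horner_mx X (chebU R j.+2)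
  = (2%:R *: X) *m horner_mx X (chebU R j.+1) - horner_mx X (chebU R j).
Proof.
by rewrite [chebU R j.+2]/(_ - _) rmorphB rmorphM /= horner_mx_double.
Qed.

Lemma horner_mx_chebT_rec k (X : 'M[R]_k.+1) j :
  horner_mx X (chebT R j.+2)
  = (2%:R *: X) *m horner_mx X (chebT R j.+1) - horner_mx X (chebT R j).
Proof.
by rewrite [chebT R j.+2]/(_ - _) rmorphB rmorphM /= horner_mx_double.
Qed.

(** For [s = -1] the recurrence starts from [0], so the second kind appears with
    its index lowered by one and [A_1] as a right factor. *)
Lemma waveMx_chebU c k (X : 'M[R]_k.+1) j :
  c * c = 1 -> 2%:R *: X = loop_pathMx (- c) k.+1 -> (j < k.+1)%N ->
  waveMx c (-1) k.+1 j.+1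
  = horner_mx X (chebU R j) *m waveMx c (-1) k.+1 1.
Proof.
move=> cc XE; have ss : (-1 : R) * -1 = 1 by rewrite mulrNN mulr1.
have rec i : (i.+1 < k.+1)%N -> waveMx c (-1) k.+1 i.+2
    = (2%:R *: X) *m waveMx c (-1) k.+1 i.+1 - waveMx c (-1) k.+1 i.
  by move=> ik; rewrite waveMx_rec // XE mulN1r.
elim/ltn_ind: j => -[|[|j]] IH jk.
- by rewrite rmorph1 mul1mx.
- by rewrite rec // waveMx0 subrr mulr0 raddf0 subr0 horner_mx_double.
- rewrite rec // horner_mx_chebU_rec mulmxBl -mulmxA.
  by rewrite -!IH //; lia.
Qed.

(** For [s = 1] both initial values are [2 c] times those of the first kind. *)
Lemma waveMx_chebT c k (X : 'M[R]_k.+1) j :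
  c * c = 1 -> 2%:R *: X = loop_pathMx c k.+1 ->
  waveMx c 1 k.+1 1 = c *: loop_pathMx c k.+1 -> (j <= k.+1)%N ->
  waveMx c 1 k.+1 j = (2%:R * c) *: horner_mx X (chebT R j).
Proof.
move=> cc XE W1; elim/ltn_ind: j => -[|[|j]] IH jk.
- by rewrite waveMx0 rmorph1 scalemx1 mulrC.
- by rewrite W1 -XE horner_mx_X scalerA mulrC.
- rewrite waveMx_rec ?mulr1 // mul1r -XE horner_mx_chebT_rec scalerBr.
  by rewrite scalemxAr -!IH //; lia.
Qed.

End Wave.

Theorem theorem2 (R : numFieldType) (k' : nat) (beta j : nat) :
  let k := k'.+1 in
  let c : R := (-1) ^+ (1 + beta) in
  (beta <= 1)%N -> (1 <= j)%N -> (j <= k %/ 2)%N ->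
  Amx R 0 beta j k =
    horner_mx (- (c / 2%:R) *: Amx R 1 (1 - beta) 1 k) (chebU R (j - 1))
      *m Amx R 0 beta 1 k
  /\
  Amx R 1 beta j k =
    (2%:R * c) *: horner_mx ((c / 2%:R) *: Amx R 1 beta 1 k) (chebT R j).
Proof.
move=> k c b1 j0 jk.
have j2k : (j.*2 <= k)%N by lia.
have k1 : (1 < k)%N by lia.
have cE : csign R beta = c by rewrite /csign addnC.
have cNE : csign R (1 - beta) = - c.
  by rewrite /c /csign; case: (beta) b1 => [|[|]] //= _; rewrite !exprS; ring.
have cc : c * c = 1 by rewrite -cE csign_sqr.
have two0 : 2%:R != 0 :> R by rewrite pnatr_eq0.
split.
- rewrite !(Amx_waveMx _ 0) // expr1 cE -[in LHS](ltn_predK j0) subn1.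
  apply: waveMx_chebU => //; last by lia.
  rewrite Amx_loop_pathMx // cNE !scalerA.
  have -> : 2%:R * - (c / 2%:R) * - c = 1 by rewrite -[RHS]cc; field.
  by rewrite scale1r.
- have W1 : waveMx c 1 k 1 = c *: loop_pathMx c k.
    by rewrite -cE -Amx_loop_pathMx // Amx_waveMx // sqrrN expr1n.
  rewrite Amx_waveMx // sqrrN expr1n cE.
  apply: waveMx_chebT => //; last by lia.
  rewrite Amx_loop_pathMx // cE !scalerA.
  by rewrite mulrCA divff // mulr1 cc scale1r.
Qed.
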